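(* Let $\alpha\in(0,1)$, let $s:\mathcal{Z}\to\mathbb{R}_+$ be a conformity score, and let $\widehat{P}^{Z^n}=(\widehat{P}^{Z_1})^n$ be an i.i.d. distribution on $\mathcal{Z}^n$. Let $\mu$ be a measure on $\mathcal{Z}$ such that $\widehat{P}^{Z_1}$ has a density $d\widehat{P}^{Z_1}/d\mu$ and $$s=m\left(\frac{d\widehat{P}^{Z_1}}{d\mu}\right)$$ for some strictly monotone function $m:[0,\infty]\to[-\infty,\infty]$. Then classical conformal prediction at level $\alpha$ based on the score $s$ minimizes the expected prediction set size $$\mathrm{E}^{\widehat{P}^{Z^n}}\left[\mu(C_\alpha^{Z^n})\right]$$ over all prediction sets that are valid at level $\alpha$ for the class of exchangeable distributions on $\mathcal{Z}^{n+1}$.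
   Context: $\mathcal{Z}$ is a measurable sample space; $\mu$ is unsigned and $\sigma$-finite. A distribution on $\mathcal{Z}^{n+1}$ is exchangeable if it is invariant under all permutations of the $n+1$ coordinates. Prediction sets are understood in the Neyman--Pearson (possibly randomized) sense: a level-$\alpha$ prediction set is a measurable map $\mathcal{E}:\mathcal{Z}^{n+1}\to[0,1/\alpha]$, where $\alpha\,\mathcal{E}(z^n,z)$ is the degree (probability) of exclusion of the point $z$ when $Z^n=z^n$; an ordinary set is the case $\mathcal{E}\in\{0,1/\alpha\}$. It is valid at level $\alpha$ if $\mathrm{E}^P[\mathcal{E}(Z^{n+1})]\le1$ for every exchangeable $P$. Its size is $\mu(C_\alpha^{z^n})=\int_{\mathcal{Z}}\left(1-\alpha\,\mathcal{E}(z^n,z)\right)d\mu(z)$, which is the usual $\mu$-measure of the set of included points when $\mathcal{E}$ is $\{0,1/\alpha\}$-valued. Classical conformal prediction at level $\alpha$ based on $s$: for $z^{n+1}=(z^n,z_{n+1})$, compare $s(z_{n+1})$ to the empirical distribution of $s(z_1),\dots,s(z_{n+1})$. If low scores indicate non-conformity (the case of increasing $m$), let $c$ be a lower $\alpha$-quantile of this empirical distribution, i.e. the fraction of $i$ with $s(z_i)<c$ is at most $\alpha$ and the fraction with $s(z_i)\le c$ is at least $\alpha$; put $\mathcal{E}(z^{n+1})=1/\alpha$ if $s(z_{n+1})<c$, $\mathcal{E}(z^{n+1})=0$ if $s(z_{n+1})>c$, and $\mathcal{E}(z^{n+1})=k$ if $s(z_{n+1})=c$, where $c$ and $k\in[0,1/\alpha]$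 depend only on the multiset $\{z_1,\dots,z_{n+1}\}$ and $k$ is such that the average of $\mathcal{E}$ over all permutations of $z^{n+1}$ equals $1$. If high scores indicate non-conformity (the case of decreasing $m$), the same with all inequalities between scores and $c$ reversed. *)

(* Defs.v *)
(* MathComp-Analysis. *)
From HB Require Import structures.
From mathcomp Require Export all_boot all_order all_algebra all_fingroup.
From mathcomp Require Export all_classical all_reals all_analysis measurable_realfun.
Export Order.TTheory GRing.Theory Num.Theory.
Export numFieldNormedType.Exports.

Set Implicit Arguments.
Unset Strict Implicit.
Unset Printing Implicit Defensive.

Local Open Scope classical_set_scope.
Local Open Scope ring_scope.
Local Open Scope ereal_scope.

Definition permute (T : Type) (n : nat) (g : {perm 'I_n}) (t : n.-tuple T) :
    n.-tuple T :=
  [tuple tnth t (g i) | i < n].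

Definition exchangeable (d : measure_display) (Z : measurableType d)
    (R : realType) (n : nat) (P : probability (n.-tuple Z) R) : Prop :=
  forall (g : {perm 'I_n}) (A : set (n.-tuple Z)), measurable A ->
    P (permute g @^-1` A) = P A.

(* [Pn] is the product measure [P]^n: the product rule on measurable rectangles
   determines a probability measure on the product sigma-algebra of tuples. *)
Definition iid (d : measure_display) (Z : measurableType d) (R : realType)
    (P : probability Z R) (n : nat) (Pn : probability (n.-tuple Z) R) : Prop :=
  forall A : 'I_n -> set Z, (forall i, measurable (A i)) ->
    Pn [set t | forall i, A i (tnth t i)] = \prod_(i < n) P (A i).

(* Densities take their values in [0, +oo]. *)
Definition is_density (d : measure_display) (Z : measurableType d)
    (R : realType) (P : probability Z R) (mu : {measure set Z -> \bar R})
    (p : Z -> \bar R) : Prop :=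
  [/\ measurable_fun [set: Z] p, (forall z, 0 <= p z) &
      forall A, measurable A -> P A = \int[mu]_(z in A) p z].

(* Strictly increasing ([incr = true]) or strictly decreasing
   ([incr = false]) on [0, +oo]; the values at negative arguments are
   irrelevant. *)
Definition strictly_monotone_nneg (R : realType) (incr : bool)
    (m : \bar R -> \bar R) : Prop :=
  forall x y, 0 <= x -> x < y -> if incr then m x < m y else m y < m x.

(* Randomized prediction set: [alpha * E (z_1, .., z_n, z)] is the probability
   that [z] is excluded after observing [z_1, .., z_n]. *)
Definition prediction_set (d : measure_display) (Z : measurableType d)
    (R : realType) (alpha : R) (n : nat) (E : n.+1.-tuple Z -> R) : Prop :=
  measurable_fun [set: n.+1.-tuple Z] E /\
  (forall t, (0 <= E t <= alpha^-1)%R).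

Definition valid_prediction_set (d : measure_display) (Z : measurableType d)
    (R : realType) (alpha : R) (n : nat) (E : n.+1.-tuple Z -> R) : Prop :=
  prediction_set alpha E /\
  (forall P : probability (n.+1.-tuple Z) R, exchangeable P -> 'E_P[E] <= 1).

Definition prediction_set_size (d : measure_display) (Z : measurableType d)
    (R : realType) (mu : {measure set Z -> \bar R}) (alpha : R) (n : nat)
    (E : n.+1.-tuple Z -> R) (t : n.-tuple Z) : \bar R :=
  \int[mu]_z (1 - alpha * E [tuple of rcons t z])%:E.

(* An extended-real integral rather than ['E_Pn[_]], since the size may be
   infinite. *)
Definition expected_size (d : measure_display) (Z : measurableType d)
    (R : realType) (n : nat) (Pn : probability (n.-tuple Z) R)
    (mu : {measure set Z -> \bar R}) (alpha : R) (E : n.+1.-tuple Z -> R) :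
    \bar R :=
  \int[Pn]_t prediction_set_size mu alpha E t.

Local Close Scope ereal_scope.

(* [less_conforming low x y]: score [x] is strictly less conforming than [y],
   where low scores indicate non-conformity iff [low]. *)
Definition less_conforming (R : realType) (low : bool) (x y : R) : bool :=
  if low then x < y else y < x.

Definition is_quantile (d : measure_display) (Z : measurableType d)
    (R : realType) (low : bool) (alpha : R) (s : Z -> R) (n : nat)
    (t : n.+1.-tuple Z) (c : R) : Prop :=
  (#|[pred i | less_conforming low (s (tnth t i)) c]|%:R / n.+1%:R <= alpha) /\
  (alpha <= #|[pred i | ~~ less_conforming low c (s (tnth t i))]|%:R / n.+1%:R).

Definition permutation_average (T : Type) (R : realType) (n : nat)
    (E : n.-tuple T -> R) (t : n.-tuple T) : R :=
  (\sum_(g : {perm 'I_n}) E (permute g t)) / (n`!)%:R.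

(* The functions [c] and [k] depend only on the multiset of the entries of the
   tuple, that is, they are invariant under permutations. Neither is unique,
   and they are only constrained through the conditions below. *)
Definition classical_conformal (d : measure_display) (Z : measurableType d)
    (R : realType) (low : bool) (alpha : R) (s : Z -> R) (n : nat)
    (E : n.+1.-tuple Z -> R) : Prop :=
  exists c k : n.+1.-tuple Z -> R,
    [/\ forall g t, c (permute g t) = c t /\ k (permute g t) = k t,
        forall t, is_quantile low alpha s t (c t),
        forall t, 0 <= k t <= alpha^-1,
        forall t, let x := s (tnth t ord_max) in
          [/\ less_conforming low x (c t) -> E t = alpha^-1,
              less_conforming low (c t) x -> E t = 0 &
              x = c t -> E t = k t] &
        forall t, permutation_average E t = 1].

(* Main.v *)
From HB Require Import structures.
From mathcomp Require Import lra ring.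
Require Import Defs.

(* With [q] the density of [P] with respect to [mu], the expected size of [E]
   is the integral of [(1 - alpha E(t)) w(t)] against the product measure
   [mu^(n+1)], where [w(t)] is the product of the [q (t_i)] over all
   coordinates but the last.  That measure is invariant under permutations, so
   the integrand may be replaced by its sum over all reorderings of [t], in
   which a candidate [t_j] carries the weight [prod_(i != j) q (t_i)], a
   nonincreasing function of [q (t_j)].  Testing the validity of a competitor
   [E'] on the uniform distribution over the reorderings of [t] bounds the
   average of [E'] by [1], which is the average of [E].  Since [E] excludes the
   candidates of lowest density, hence of largest weight, the Neyman-Pearson
   argument gives the inequality separately for each [t]. *)

Set Implicit Arguments.
Unset Strict Implicit.
Unset Printing Implicit Defensive.

Local Open Scope classical_set_scope.
Local Open Scope ring_scope.

(** * Product measures on tuples *)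

(* Built by a tactic because the measure instance of [pushforward] takes the
   measurability of [f] as an argument that unification cannot find. *)
Definition image_measure d1 d2 (T1 : measurableType d1)
    (T2 : measurableType d2) (R : realType) (m : {measure set T1 -> \bar R})
    (f : T1 -> T2) (mf : measurable_fun setT f) : {measure set T2 -> \bar R}.
Proof. by refine (pushforward m f : {measure set T2 -> \bar R}). Defined.

Section product_measure.
Context d (Z : measurableType d) (R : realType).
Local Open Scope ereal_scope.

Definition tuple_box n (A : 'I_n -> set Z) : set (n.-tuple Z) :=
  [set t | forall i, A i (tnth t i)].

Lemma measurable_tuple_box n (A : 'I_n -> set Z) :
  (forall i, measurable (A i)) -> measurable (tuple_box A).
Proof.
move=> mA; rewrite (_ : tuple_box A =
    \bigcap_(i in [set: 'I_n]) (@tnth n Z ^~ i @^-1` A i)).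
  apply: fin_bigcap_measurable => // i _.
  by rewrite -[X in measurable X]setTI; exact: measurable_tnth.
by apply/seteqP; split=> t /= tA i; [move=> _|]; exact: tA.
Qed.

(** Boxes are closed under intersection, as the uniqueness theorem for measures requires of a
    generating class. A coordinate preimage is the box whose other sides are the whole space. *)
Lemma measurable_tuple_boxE n :
  @measurable _ (n.-tuple Z) =
  <<s [set B | exists2 A : 'I_n -> set Z,
        (forall i, measurable (A i)) & B = tuple_box A] >>.
Proof.
apply/seteqP; split.
- apply: smallest_sub; first exact: smallest_sigma_algebra.
  rewrite -bigcup_seq => B [i _ [A mA <-]]; apply: sub_sigma_algebra.
  exists (fun j => if j == i then A else setT) => [j|].
    by case: ifP.
  apply/seteqP; split=> t /=.
    by move=> [_ At] j; case: ifPn => // /eqP ->.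
  by move=> /(_ i); rewrite eqxx.
- apply: smallest_sub; first exact: sigma_algebra_measurable.
  by move=> _ [A mA ->]; exact: measurable_tuple_box.
Qed.

(** For a probability [mu] this unfolds to [iid], so the law of the sample and the possibly infinite
    powers of the reference measure are treated alike. *)
Definition product_rule (mu : set Z -> \bar R) n
    (M : set (n.-tuple Z) -> \bar R) :=
  forall A : 'I_n -> set Z, (forall i, measurable (A i)) ->
    M (tuple_box A) = \prod_(i < n) mu (A i).

(** The bound is stated for every [M] obeying the product rule, so it also serves to show that a
    newly built product measure is sigma-finite. *)
Lemma tuple_box_cover (mu : {sigma_finite_measure set Z -> \bar R}) n :
  exists F : nat -> set Z,
  [/\ \bigcup_k tuple_box (fun _ : 'I_n => F k) = setT,
      forall k, measurable (F k) &
      forall (M : set (n.-tuple Z) -> \bar R), product_rule mu M ->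
        forall k, M (tuple_box (fun _ : 'I_n => F k)) < +oo].
Proof.
have /sigma_finiteP[F [TF ndF Foo]] := sigma_finiteT mu.
exists F; split=> [|k|M MF k]; last 2 first.
- by have [] := Foo k.
- rewrite MF; last by move=> _; have [] := Foo k.
  rewrite -ge0_fin_numE; last by apply: prode_ge0.
  rewrite prode_fin_num// => i _; rewrite ge0_fin_numE//.
  by have [] := Foo k.
apply/seteqP; split=> // t _.
have /(_ _)/cid-/all_sig[k tk] : forall i, exists k, F k (tnth t i).
  by move=> i; have : setT (tnth t i) by []; rewrite TF => -[k _]; exists k.
(* The sets [F k] increase, so the largest of the finitely many indices serves all coordinates. *)
exists (\max_i k i) => // i.
move: (tk i); exact/subsetPset/ndF/leq_bigmax.
Qed.

Lemma product_rule_unique (mu : {sigma_finite_measure set Z -> \bar R}) n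
    (M1 M2 : {measure set (n.-tuple Z) -> \bar R}) :
  product_rule mu M1 -> product_rule mu M2 ->
  forall A, measurable A -> M1 A = M2 A.
Proof.
move=> M1mu M2mu A mA.
have [F [FT mF Foo]] := tuple_box_cover mu n.
apply: (measure_unique _ _ (@measurable_tuple_boxE n) _ _ FT) => //.
- move=> _ _ [B mB ->] [C mC ->]; exists (fun i => B i `&` C i) => [i|].
    exact: measurableI.
  apply/seteqP; split=> [t [tB tC] i|t tBC]; first by split.
  by split=> i; have [] := tBC i.
- by move=> k; exists (fun _ => F k).
- by move=> _ [B mB ->]; rewrite M1mu// M2mu.
- by move=> k; exact: Foo.
Qed.

Definition rcons_pair n (tz : n.-tuple Z * Z) : n.+1.-tuple Z :=
  [tuple of rcons tz.1 tz.2].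

Lemma tnth_rcons_widen n (t : n.-tuple Z) z (i : 'I_n) :
  tnth [tuple of rcons t z] (widen_ord (leqnSn n) i) = tnth t i.
Proof.
by rewrite !(tnth_nth z)/= nth_rcons size_tuple ltn_ord.
Qed.

Lemma tnth_rcons_max n (t : n.-tuple Z) z :
  tnth [tuple of rcons t z] ord_max = z.
Proof. by rewrite (tnth_nth z)/= nth_rcons size_tuple ltnn eqxx. Qed.


Lemma measurable_rcons_pair n :
  measurable_fun [set: n.-tuple Z * Z] (@rcons_pair n).
Proof.
apply/measurable_fun_tnthP => i.
have [j ->|->] := unliftP ord_max i.
  rewrite (_ : _ \o _ = (@tnth n Z ^~ j) \o fst).
    by apply: measurableT_comp => //; exact: measurable_tnth.
  apply/funext => -[t z] /=; rewrite -(tnth_rcons_widen t z).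
  by congr tnth; apply/val_inj => /=; rewrite /bump leqNgt ltn_ord.
rewrite (_ : _ \o _ = snd) //.
by apply/funext => -[t z] /=; rewrite tnth_rcons_max.
Qed.

Lemma rcons_pair_preimage_box n (A : 'I_n.+1 -> set Z) :
  @rcons_pair n @^-1` tuple_box A =
  tuple_box (fun i => A (widen_ord (leqnSn n) i)) `*` A ord_max.
Proof.
apply/seteqP; split=> -[t z] /=.
  move=> tA; split=> [i /=|/=].
    by rewrite -(tnth_rcons_widen t z); exact: tA.
  by rewrite -[z in A _ z](tnth_rcons_max t); exact: tA.
move=> [tA zA] i; have [j ->|->] := unliftP ord_max i; last first.
  by rewrite tnth_rcons_max.
rewrite (_ : lift _ _ = widen_ord (leqnSn n) j).
  by rewrite tnth_rcons_widen; exact: tA.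
by apply/val_inj => /=; rewrite /bump leqNgt ltn_ord.
Qed.

(** * Appending a coordinate: existence of product measures and Tonelli *)

Section rcons_measure.
Variables (n : nat) (M : {sigma_finite_measure set (n.-tuple Z) -> \bar R}).
Variable mu : {sigma_finite_measure set Z -> \bar R}.

Definition rcons_measure : {measure set (n.+1.-tuple Z) -> \bar R} :=
  image_measure (M \x mu) (@measurable_rcons_pair n).

Lemma integral_rcons_measure f :
  measurable_fun setT f -> (forall t, 0 <= f t) ->
  \int[rcons_measure]_t f t =
  \int[M]_t \int[mu]_z f [tuple of rcons t z].
Proof.
move=> mf f0; have mrcons := @measurable_rcons_pair n.
rewrite ge0_integral_pushforward// preimage_setT fubini_tonelli1//=.
exact: measurableT_comp.
Qed.

Lemma rcons_measure_rule (nu : set Z -> \bar R) : product_rule nu M ->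
  (forall A, measurable A -> nu A = mu A) ->
  product_rule nu rcons_measure.
Proof.
move=> Mnu numu A mA.
rewrite /= /pushforward rcons_pair_preimage_box product_measure1E//=.
  by rewrite Mnu// -numu// big_ord_recr.
exact: measurable_tuple_box.
Qed.

End rcons_measure.

(** Induction on [n] from the Dirac mass at the empty tuple. Sigma-finiteness is carried along
    because the product with [mu] in the next step relies on it. *)
Lemma product_measure_exists (mu : {sigma_finite_measure set Z -> \bar R}) n :
  exists M : {sigma_finite_measure set (n.-tuple Z) -> \bar R},
    product_rule mu M.
Proof.
elim: n => [|n [M Mmu]].
  exists (\d_([tuple] : 0.-tuple Z)) => A mA.
  by rewrite big_ord0/= diracE mem_set// => -[].
pose N := rcons_measure M mu.
have Nmu : product_rule mu N by exact: rcons_measure_rule.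
have [F [FT mF Foo]] := tuple_box_cover mu n.+1.
have sfN : sigma_finite setT N.
  exists (fun k => tuple_box (fun _ => F k)) => [//|k]; split.
    exact: measurable_tuple_box.
  exact: Foo.
pose sN : {sigma_finite_measure set (n.+1.-tuple Z) -> \bar R} :=
  HB.pack (N : set _ -> \bar R) (Measure.class N)
    (Measure_isSigmaFinite.Build _ _ _ _ sfN).
by exists sN.
Qed.

(** By uniqueness [N] coincides with [rcons_measure M mu], however it was obtained, so Tonelli
    applies to it. *)
Lemma integral_product_rule_rcons
    (mu : {sigma_finite_measure set Z -> \bar R}) n
    (M : {sigma_finite_measure set (n.-tuple Z) -> \bar R})
    (N : {measure set (n.+1.-tuple Z) -> \bar R}) f :
  product_rule mu M -> product_rule mu N ->
  measurable_fun setT f -> (forall t, 0 <= f t) ->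
  \int[N]_t f t = \int[M]_t \int[mu]_z f [tuple of rcons t z].
Proof.
move=> Mmu Nmu mf f0; rewrite -integral_rcons_measure//.
apply: eq_measure_integral => A mA _.
by apply: (product_rule_unique Nmu _ mA); exact: rcons_measure_rule.
Qed.

Lemma measurable_permute n (g : {perm 'I_n}) :
  measurable_fun [set: n.-tuple Z] (permute g).
Proof.
apply/measurable_fun_tnthP => i; rewrite (_ : _ \o _ = @tnth n Z ^~ (g i)).
  exact: measurable_tnth.
by apply/funext => t /=; rewrite tnth_mktuple.
Qed.

Lemma permute_preimage_box n (g : {perm 'I_n}) (A : 'I_n -> set Z) :
  permute g @^-1` tuple_box A = tuple_box (fun i => A (g^-1%g i)).
Proof.
apply/seteqP; split=> t /= tA i.
  by have := tA (g^-1%g i); rewrite tnth_mktuple permKV.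
by rewrite tnth_mktuple; have := tA (g i); rewrite permK.
Qed.

(** * Permutation invariance and symmetrization of integrals *)

Section permute_invariance.
Variables (n : nat) (M : {measure set (n.-tuple Z) -> \bar R}).

(** This is [exchangeable] without the restriction to probabilities, so that it covers powers of
    [mu]. *)
Definition permute_invariant := forall g A, measurable A ->
  M (permute g @^-1` A) = M A.

(** The image of [M] under a reordering satisfies the same product rule, because the order of the
    factors is irrelevant; uniqueness concludes. *)
Lemma product_rule_permute_invariant
    (mu : {sigma_finite_measure set Z -> \bar R}) :
  product_rule mu M -> permute_invariant.
Proof.
move=> Mmu g A mA.
pose Mg := image_measure M (measurable_permute g).
apply: (product_rule_unique (M1 := Mg) (mu := mu)) => // B mB.
rewrite /= /pushforward /= permute_preimage_box Mmu//.
rewrite (reindex_inj (@perm_inj _ g))/=.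
by apply: eq_bigr => i _; rewrite permK.
Qed.

Hypothesis Minv : permute_invariant.

Lemma integral_permute g f : measurable_fun setT f -> (forall t, 0 <= f t) ->
  \int[M]_t f (permute g t) = \int[M]_t f t.
Proof.
have mg := @measurable_permute n g.
move=> mf f0; transitivity (\int[image_measure M mg]_t f t).
  by rewrite [RHS]ge0_integral_pushforward// ?preimage_setT.
by apply: eq_measure_integral => A mA _; exact: Minv.
Qed.

(** Applied to an exchangeable law it yields validity; applied to a power of [mu] it reduces
    optimality to single orbits. *)
Lemma integral_sum_permute f : measurable_fun setT f -> (forall t, 0 <= f t) ->
  \int[M]_t (\sum_(g : {perm 'I_n}) f (permute g t)) =
  (n`!%:R)%:E * \int[M]_t f t.
Proof.
move=> mf f0; rewrite ge0_integral_sum//=; last first.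
  by move=> g; apply: measurableT_comp => //; exact: measurable_permute.
under eq_bigr do rewrite integral_permute//.
by rewrite big_const mule_natl -card_Sn -Monoid.iteropE.
Qed.

End permute_invariance.


Lemma measurable_prod_tnth (q : Z -> R) n m (h : 'I_m -> 'I_n) :
  measurable_fun [set: Z] q ->
  measurable_fun [set: n.-tuple Z]
    (fun t => (\prod_(i < m) q (tnth t (h i)))%R).
Proof.
move=> mq; apply: measurable_prod => i _.
by apply: measurableT_comp => //; exact: measurable_tnth.
Qed.

(** * Densities of product measures *)

Section product_density.
Variables (P mu : {sigma_finite_measure set Z -> \bar R}) (q : Z -> R).
Hypotheses (mq : measurable_fun setT q) (q0 : forall z, (0 <= q z)%R).
Hypothesis Pq : forall f, measurable_fun setT f -> (forall z, 0 <= f z) ->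
  \int[P]_z f z = \int[mu]_z (f z * (q z)%:E).

Lemma integral_product_density n
    (Pn M : {sigma_finite_measure set (n.-tuple Z) -> \bar R}) f :
  product_rule P Pn -> product_rule mu M ->
  measurable_fun setT f -> (forall t, 0 <= f t) ->
  \int[Pn]_t f t = \int[M]_t (f t * (\prod_(i < n) q (tnth t i))%R%:E).
Proof.
elim: n => [|n IHn] in Pn M f * => PnP Mmu mf f0.
  under [RHS]eq_integral do rewrite big_ord0 mule1.
  apply: eq_measure_integral => A mA _.
  apply: (product_rule_unique PnP _ mA) => B mB.
  by have := Mmu B mB; rewrite !big_ord0.
have [Pn' Pn'P] := product_measure_exists P n.
have [M' M'mu] := product_measure_exists mu n.
have mfr : measurable_fun setT (f \o @rcons_pair n).
  by apply: measurableT_comp => //; exact: measurable_rcons_pair.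
have q0' m (t : m.-tuple Z) : (0 <= \prod_(i < m) q (tnth t i))%R.
  by apply: prodr_ge0.
rewrite (integral_product_rule_rcons Pn'P PnP)//.
rewrite (integral_product_rule_rcons M'mu Mmu)//; last 2 first.
- apply: emeasurable_funM => //; apply/measurable_EFinP.
  exact: (measurable_prod_tnth id).
- by move=> t; rewrite mule_ge0// lee_fin.
have mg : measurable_fun [set: n.-tuple Z * Z]
    (fun tz => f [tuple of rcons tz.1 tz.2] * (q tz.2)%:E).
  apply: emeasurable_funM => //; apply/measurable_EFinP.
  exact: measurableT_comp.
transitivity (\int[Pn']_t \int[mu]_z (f [tuple of rcons t z] * (q z)%:E)).
  apply: eq_integral => t _; rewrite Pq//.
  exact: (measurableT_comp mfr (pair1_measurable t)).
(* The last coordinate has been converted to [mu] by [Pq]; the induction hypothesis is applied to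
   the resulting inner integral as a function of the first [n] coordinates. *)
rewrite (IHn _ _ _ Pn'P M'mu); last 2 first.
- apply: (measurable_fun_fubini_tonelli_F _ mg) => tz.
  by rewrite mule_ge0// lee_fin.
- by move=> t; apply: integral_ge0 => z _; rewrite mule_ge0// lee_fin.
apply: eq_integral => t _; rewrite -ge0_integralZr//; last 3 first.
- exact: (measurableT_comp mg (pair1_measurable t)).
- by move=> z _; rewrite mule_ge0// lee_fin.
- by rewrite lee_fin.
apply: eq_integral => z _; rewrite big_ord_recr/= tnth_rcons_max.
rewrite mulrC EFinM muleA; congr (_ * (_)%:E)%E.
by apply: eq_bigr => i _; rewrite tnth_rcons_widen.
Qed.

(** The last coordinate is the candidate, integrated against [mu] rather than drawn from [P], so it
    contributes no density factor. *)
Lemma integral_iid_rcons n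
    (Pn : {sigma_finite_measure set (n.-tuple Z) -> \bar R})
    (M : {measure set (n.+1.-tuple Z) -> \bar R}) f :
  product_rule P Pn -> product_rule mu M ->
  measurable_fun setT f -> (forall t, 0 <= f t) ->
  \int[Pn]_t \int[mu]_z f [tuple of rcons t z] =
  \int[M]_t (f t * (\prod_(i < n) q (tnth t (widen_ord (leqnSn n) i)))%R%:E).
Proof.
move=> PnP Mmu mf f0.
have [M' M'mu] := product_measure_exists mu n.
have mfr : measurable_fun setT (f \o @rcons_pair n).
  by apply: measurableT_comp => //; exact: measurable_rcons_pair.
rewrite (integral_product_density PnP M'mu); last 2 first.
- by apply: (measurable_fun_fubini_tonelli_F _ mfr) => tz; exact: f0.
- by move=> t; apply: integral_ge0 => z _.
rewrite (integral_product_rule_rcons M'mu Mmu); last 2 first.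
- apply: emeasurable_funM => //; apply/measurable_EFinP.
  exact: measurable_prod_tnth.
- by move=> t; rewrite mule_ge0// lee_fin prodr_ge0.
apply: eq_integral => t _; rewrite -ge0_integralZr//; last 2 first.
- exact: (measurableT_comp mfr (pair1_measurable t)).
- by rewrite lee_fin prodr_ge0.
apply: eq_integral => z _; congr (_ * (_)%:E)%E.
by apply: eq_bigr => i _; rewrite tnth_rcons_widen.
Qed.

End product_density.

(** The exceptional tuples for coordinate [i] lie in a box with one null side. Its mass is [0] even
    if other sides have infinite mass, by the convention that [0 * +oo] is [0]. *)
Lemma product_rule_ae (mu : {measure set Z -> \bar R}) n
    (M : {measure set (n.-tuple Z) -> \bar R}) (Q : Z -> Prop) :
  product_rule mu M -> {ae mu, forall z, Q z} ->
  {ae M, forall t i, Q (tnth t i)}.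
Proof.
move=> Mmu [A [mA A0 QA]].
apply: filter_forall => i.
exists (tuple_box (fun j => if j == i then A else setT)); split.
- by apply: measurable_tuple_box => j; case: ifP.
- rewrite Mmu; last by move=> j; case: ifP.
  by rewrite (bigD1 i)//= eqxx A0 mul0e.
- by move=> t /= Qt j; case: ifPn => // /eqP ->; exact: QA.
Qed.

End product_measure.

(** * Classical conformal prediction *)

(** A uniformly random permutation sends [i] to a uniformly random index: composing with a
    transposition shows that the sum does not depend on [i], and summing over all [i] evaluates
    it. *)
Lemma sum_perm_apply (R : numDomainType) n (f : 'I_n.+1 -> R) (i : 'I_n.+1) :
  n.+1%:R * (\sum_(g : {perm 'I_n.+1}) f (g i)) =
  (n.+1)`!%:R * \sum_(j < n.+1) f j.
Proof.
have fi j : \sum_(g : {perm 'I_n.+1}) f (g j) =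
    \sum_(g : {perm 'I_n.+1}) f (g i).
  rewrite (reindex_inj (mulgI (tperm i j)))/=.
  by apply: eq_bigr => g _; rewrite permM tpermR.
transitivity (\sum_(j < n.+1) \sum_(g : {perm 'I_n.+1}) f (g j)).
  by rewrite (eq_bigr _ (fun j _ => fi j)) sumr_const card_ord mulr_natl.
rewrite exchange_big/=.
rewrite (eq_bigr (fun=> \sum_(j < n.+1) f j)) => [|g _]; last first.
  by rewrite [RHS](reindex_inj (@perm_inj _ g)).
by rewrite big_const -card_Sn mulr_natl -Monoid.iteropE.
Qed.

Section conformity_order.
Variables (R : realType) (low : bool).

(** The sign reduces decreasing [m] to increasing [m]: low oriented scores always indicate
    non-conformity. *)
Definition orient (x : R) : R := if low then x else - x.

Lemma less_conformingE x y : less_conforming low x y = (orient x < orient y).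
Proof. by rewrite /less_conforming /orient; case: low => //; rewrite ltrN2. Qed.

Lemma orient_inj : injective orient.
Proof. by rewrite /orient => x y; case: low => // /oppr_inj. Qed.

Lemma measurable_orient : measurable_fun [set: R] orient.
Proof.
rewrite /orient; case: low; first exact: measurable_id.
exact: oppr_measurable.
Qed.

(* The value of a classical conformal predictor on a candidate of oriented
   score [x], when the oriented quantile is [c]. *)
Definition exclusion (a k c x : R) : R :=
  if x < c then a else if c < x then 0 else k.

Lemma exclusion_itv a k c x : 0 <= k <= a -> 0 <= exclusion a k c x <= a.
Proof.
move=> /andP[k0 ka]; rewrite /exclusion.
case: ifPn => _; first by rewrite lexx (le_trans k0).
by case: ifPn => _; rewrite ?lexx ?k0 // (le_trans k0).
Qed.

Lemma sum_exclusion n (x : 'I_n -> R) a k c :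
  \sum_i exclusion a k c (x i) =
  a * (\sum_i (x i < c)%R%:R) + k * (\sum_i (x i == c)%:R).
Proof.
rewrite !mulr_sumr -big_split/=; apply: eq_bigr => i _.
rewrite /exclusion.
by case: (ltgtP (x i) c) => _; rewrite ?mulr1 ?mulr0 ?addr0 ?add0r.
Qed.

(* The normalization of the average determines the exclusion degrees from the
   ranks alone, whatever the choice of [c] and [k]. *)
Lemma exclusion_rankE n (x : 'I_n -> R) a k c (j : 'I_n) :
  0 <= k <= a -> \sum_i exclusion a k c (x i) = n%:R ->
  exclusion a k c (x j) =
  Num.max 0 (Num.min a ((n%:R - a * (\sum_i (x i < x j)%R%:R)) /
                         (\sum_i (x i == x j)%:R))).
Proof.
move=> /andP[k0 ka]; rewrite sum_exclusion => sumE.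
set A := \sum_i (x i < x j)%R%:R; set B := \sum_i (x i == x j)%:R.
have B0 : 0 < B.
  rewrite /B (bigD1 j)//= eqxx ltr_pwDl//.
  by apply: sumr_ge0.
set Ac := \sum_i (x i < c)%R%:R in sumE; set Bc := \sum_i (x i == c)%:R in sumE.
have Bc0 : 0 <= Bc by apply: sumr_ge0.
have a0 : 0 <= a by exact: le_trans ka.
(* Below [c], [A + B <= Ac] makes the quotient at least [a]; above [c], [Ac + Bc <= A] makes it
   nonpositive; at [c] it is exactly [k]. The clipping to [[0, a]] thus returns the right value each
   time. *)
rewrite /exclusion; case: (ltgtP (x j) c) => xc.
- have ABAc : A + B <= Ac.
    rewrite /A /B /Ac -big_split/=; apply: ler_sum => i _.
    case: (ltgtP (x i) (x j)) => [xij|_|->]; rewrite ?addr0 ?add0r ?xc//.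
    by rewrite (lt_trans xij xc).
  rewrite min_l ?max_r// ler_pdivlMr//; nra.
- have AcA : Ac + Bc <= A.
    rewrite /A /Bc /Ac -big_split/=; apply: ler_sum => i _.
    case: (ltgtP (x i) c) => [xij|_|->]; rewrite ?addr0 ?add0r ?xc//.
    by rewrite (lt_trans xij xc).
  rewrite max_l// ge_min ler_pdivrMr// mul0r; apply/orP; right; nra.
- have -> : (n%:R - a * A) / B = k.
    have BE : B = Bc by rewrite /B xc.
    by rewrite -sumE /A xc -/Ac -BE addrC addKr mulfK// gt_eqF.
  by rewrite min_r// max_r.
Qed.

End conformity_order.

Lemma permute1 (T : Type) n (t : n.-tuple T) : permute 1%g t = t.
Proof. by apply: eq_from_tnth => i; rewrite tnth_mktuple perm1. Qed.

Lemma permuteM (T : Type) n (g h : {perm 'I_n}) (t : n.-tuple T) :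
  permute g (permute h t) = permute (g * h)%g t.
Proof. by apply: eq_from_tnth => i; rewrite !tnth_mktuple permM. Qed.

Lemma natr_card (R : pzSemiRingType) (I : finType) (Q : pred I) :
  #|[pred i | Q i]|%:R = \sum_i (Q i)%:R :> R.
Proof.
rewrite -sum1_card natr_sum big_mkcond/=.
by apply: eq_bigr => i _; rewrite inE; case: (Q i).
Qed.

(** * Existence, measurability and validity of the classical predictor *)

Section classical.
Context d (Z : measurableType d) (R : realType).
Variables (low : bool) (alpha : R) (s : Z -> R) (n : nat).
Hypothesis alpha01 : 0 < alpha < 1.
Implicit Types (t : n.+1.-tuple Z) (E : n.+1.-tuple Z -> R).

Let y t i := orient low (s (tnth t i)).

Let y_permute g t i : y (permute g t) i = y t (g i).
Proof. by rewrite /y tnth_mktuple. Qed.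

Let alpha_gt0 : 0 < alpha. Proof. by case/andP: alpha01. Qed.

Lemma is_quantileE t c : is_quantile low alpha s t c <->
  \sum_i (y t i < orient low c)%R%:R <= alpha * n.+1%:R /\
  alpha * n.+1%:R <= \sum_i (y t i <= orient low c)%R%:R.
Proof.
rewrite /is_quantile !natr_card ler_pdivrMr ?ltr0n// ler_pdivlMr ?ltr0n//.
under eq_bigr do rewrite less_conformingE.
by under [X in _ * _ <= X]eq_bigr do rewrite less_conformingE -leNgt.
Qed.

Lemma is_quantile_permute g t c :
  is_quantile low alpha s (permute g t) c <-> is_quantile low alpha s t c.
Proof.
rewrite !is_quantileE.
under eq_bigr do rewrite y_permute.
under [X in _ * _ <= X]eq_bigr do rewrite y_permute.
rewrite [in X in _ <-> X](reindex_inj (@perm_inj _ g))/=.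
by rewrite [X in _ <-> (_ /\ _ <= X)](reindex_inj (@perm_inj _ g))/=.
Qed.

(** The least oriented score at which the empirical distribution function reaches [alpha] works: the
    count strictly below it is zero or the value of [F] at the next lower score, which misses the
    level by minimality. *)
Lemma is_quantile_exists t : exists c, is_quantile low alpha s t c.
Proof.
pose F x : R := \sum_i (y t i <= x)%R%:R.
pose P i := alpha * n.+1%:R <= F (y t i).
have [i0 Pi0] : exists i, P i.
  pose i0 := [arg max_(i > ord0 | xpredT i) y t i]%O; exists i0.
  rewrite /P /F /i0; case: arg_maxP => // i _ ymax.
  rewrite (eq_bigr (fun=> 1)) => [|j _].
    by rewrite sumr_const card_ord ler_piMl// ltW//; case/andP: alpha01.
  by have -> : y t j <= y t i by exact: ymax.
have [i Pi ymin] := arg_minP (y t) Pi0.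
exists (s (tnth t i)); apply/is_quantileE; split; last exact: Pi.
have [[j0 /= j0i]|noj] := pselect (exists j, y t j < y t i).
  have [j ji ymax] :=
    @arg_maxP _ _ _ j0 (fun l => y t l < y t i) (y t) j0i.
  apply: (@le_trans _ _ (F (y t j))).
    apply: ler_sum => l _; case: (ltP (y t l)) => // li.
    by have -> : y t l <= y t j by exact: ymax.
  rewrite leNgt; apply/negP => /ltW /ymin.
  by rewrite leNgt ji.
rewrite big1 ?mulr_ge0 ?ltW// => j _.
by case: ltP => // ji; case: noj; exists j.
Qed.

Lemma classical_conformal_exists : exists E, classical_conformal low alpha s E.
Proof.
(* Reorderings of [t] have the same set of quantiles, so choosing from the set itself makes [c]
   permutation invariant. *)
pose c t := xget 0 [set c | is_quantile low alpha s t c].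
pose A t : R := \sum_i (y t i < orient low (c t))%R%:R.
pose B t : R := \sum_i (y t i == orient low (c t))%:R.
(* Solves the normalization [alpha^-1 * A t + k t * B t = n.+1]; the two quantile inequalities place
   the solution in [[0, alpha^-1]]. *)
pose k t := (n.+1%:R - alpha^-1 * A t) / B t.
have cP t : is_quantile low alpha s t (c t).
  by have [x xq] := is_quantile_exists t; exact: (xgetI 0 xq).
have c_perm g t : c (permute g t) = c t.
  rewrite /c; congr xget; apply/seteqP.
  by split=> x /=; rewrite is_quantile_permute.
have A_perm g t : A (permute g t) = A t.
  rewrite /A c_perm [RHS](reindex_inj (@perm_inj _ g))/=.
  by apply: eq_bigr => i _; rewrite y_permute.
have B_perm g t : B (permute g t) = B t.
  rewrite /B c_perm [RHS](reindex_inj (@perm_inj _ g))/=.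
  by apply: eq_bigr => i _; rewrite y_permute.
have k_perm g t : k (permute g t) = k t by rewrite /k A_perm B_perm.
have B0 t : 0 <= B t by apply: sumr_ge0.
have AB t : A t <= alpha * n.+1%:R <= A t + B t.
  have /is_quantileE[-> /le_trans ->//] := cP t.
  rewrite /A /B -big_split/=; apply: ler_sum => i _.
  by case: ltgtP; rewrite ?addr0 ?add0r.
have kB t : k t * B t = n.+1%:R - alpha^-1 * A t.
  (* If no score equals [c t], division by zero gives [k t = 0], and the quantile inequalities force
     [A t = alpha * n.+1], so the normalization still holds. *)
  rewrite /k; have [B_eq0|B_neq0] := eqVneq (B t) 0; last by rewrite divfK.
  move: (AB t); rewrite B_eq0 addr0 mulr0 => /le_anti ->.
  by rewrite mulKf ?subrr// gt_eqF.
exists (fun t => exclusion alpha^-1 (k t) (orient low (c t)) (y t ord_max)).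
exists c, k; split => // [t|t|t].
- have /andP[A1 A2] := AB t.
  have : 0 <= n.+1%:R - alpha^-1 * A t.
    by rewrite subr_ge0 mulrC ler_pdivrMr// mulrC.
  move=> k0; rewrite divr_ge0//= /k.
  have [->|B_neq0] := eqVneq (B t) 0.
    by rewrite invr0 mulr0 invr_ge0 ltW.
  rewrite ler_pdivrMr ?lt0r ?B_neq0 ?B0// lerBlDr -mulrDr.
  by rewrite mulrC ler_pdivlMr// mulrC addrC.
- rewrite /exclusion !less_conformingE -/(y t ord_max); split.
  + by move=> ->.
  + by move=> /[dup] /lt_gtF -> ->.
  + by rewrite /y => ->; rewrite ltxx.
- rewrite /permutation_average.
  under eq_bigr do rewrite k_perm c_perm y_permute.
  have := sum_perm_apply
    (fun i => exclusion alpha^-1 (k t) (orient low (c t)) (y t i)) ord_max.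
  rewrite sum_exclusion -/(A t) -/(B t) kB addrC subrK [RHS]mulrC => /mulfI ->.
    by rewrite divff// pnatr_eq0 -lt0n fact_gt0.
  by rewrite pnatr_eq0.
Qed.

(** On the whole orbit of [t] the predictor uses one threshold, here already oriented, and one
    boundary value. Only the entry moved to the last place varies, so the average over permutations
    becomes an average over entries. *)
Lemma classical_conformalP E : classical_conformal low alpha s E ->
  exists c k : n.+1.-tuple Z -> R, forall t,
   [/\ 0 <= k t <= alpha^-1,
      forall g, E (permute g t) =
        exclusion alpha^-1 (k t) (c t) (y t (g ord_max)) &
      \sum_i exclusion alpha^-1 (k t) (c t) (y t i) = n.+1%:R].
Proof.
move=> [c [k [ck_perm _ k_itv EP Eavg]]]; exists (orient low \o c), k => t.
have Eg g : E (permute g t) =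
    exclusion alpha^-1 (k t) (orient low (c t)) (y t (g ord_max)).
  have [] := EP (permute g t); have [-> ->] := ck_perm g t.
  rewrite !less_conformingE tnth_mktuple -/(y t (g ord_max)) => Elt Egt Eeq.
  rewrite /exclusion; by case: ltgtP => // /orient_inj; exact: Eeq.
split=> //.
have := Eavg t; rewrite /permutation_average; under eq_bigr do rewrite Eg.
move=> /divr1_eq sumE; have := sum_perm_apply
  (fun i => exclusion alpha^-1 (k t) (orient low (c t)) (y t i)) ord_max.
by rewrite sumE [LHS]mulrC => /mulfI <-.
Qed.


Lemma classical_conformal_itv E t :
  classical_conformal low alpha s E -> 0 <= E t <= alpha^-1.
Proof.
move=> /classical_conformalP[c [k /(_ t)[k_itv /(_ 1%g)]]].
by rewrite permute1 => -> _; exact: exclusion_itv.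
Qed.

Lemma classical_conformal_sum E t : classical_conformal low alpha s E ->
  \sum_(g : {perm 'I_n.+1}) E (permute g t) = (n.+1)`!%:R.
Proof.
move=> [c [k [_ _ _ _ /(_ t) /divr1_eq]]]; exact.
Qed.

Hypothesis ms : measurable_fun [set: Z] s.

Let my i : measurable_fun [set: n.+1.-tuple Z] (y ^~ i).
Proof.
apply: measurableT_comp; first exact: measurable_orient.
by apply: measurableT_comp => //; exact: measurable_tnth.
Qed.

(** Nothing is assumed about the measurability of [c] and [k]; [exclusion_rankE] eliminates them in
    favour of counts of score comparisons. *)
Lemma classical_conformal_measurable E :
  classical_conformal low alpha s E -> measurable_fun [set: n.+1.-tuple Z] E.
Proof.
move=> /classical_conformalP[c [k EP]].
pose A t : R := \sum_i (y t i < y t ord_max)%R%:R.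
pose B t : R := \sum_i (y t i == y t ord_max)%:R.
have nat_of_bool_mfun (b : n.+1.-tuple Z -> bool) :
    measurable_fun setT b -> measurable_fun setT (fun t => (b t)%:R : R).
  move=> mb; rewrite (_ : (fun _ => _) = fun t => if b t then 1 else 0).
    exact: measurable_fun_ifT.
  by apply/funext => t; case: (b t).
have mA : measurable_fun setT A.
  apply: measurable_sum => i; apply: nat_of_bool_mfun.
  exact: measurable_fun_ltr.
have mB : measurable_fun setT B.
  apply: measurable_sum => i; apply: nat_of_bool_mfun.
  exact: measurable_fun_eqr.
have B0 t : 0 <= B t by apply: sumr_ge0.
(* The inverse of [B t] is written as a real power; the two agree because [B t] is nonnegative. *)
rewrite (_ : E = (cst 0) \max ((cst alpha^-1) \min
    ((fun t => n.+1%:R - alpha^-1 * A t) \* (fun t => B t `^ (-1))))).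
  apply: measurable_maxr => //; apply: measurable_minr => //.
  apply: measurable_funM.
    by apply: measurable_funB => //; exact: measurable_funM.
  by apply: (measurableT_comp (@measurable_powR R (-1))).
apply/funext => t; have [k_itv /(_ 1%g) + sumE] := EP t.
rewrite permute1 perm1 => ->.
by rewrite (exclusion_rankE _ k_itv sumE) /= powR_inv1.
Qed.

(** After symmetrization the integrand is the constant [(n.+1)!], so the expectation equals [1]
    under every exchangeable law. *)
Lemma classical_conformal_valid E :
  classical_conformal low alpha s E -> valid_prediction_set alpha E.
Proof.
move=> EC; have mE := classical_conformal_measurable EC.
have E_itv t := classical_conformal_itv t EC.
split=> [|P Pexch]; first by split.
have mEE : measurable_fun setT (EFin \o E) by exact/measurable_EFinP.
have E0 t : (0 <= (EFin \o E) t)%E by rewrite lee_fin; case/andP: (E_itv t).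
have fact0 : (0 < (n.+1)`!%:R :> R) by rewrite ltr0n fact_gt0.
rewrite unlock -(@lee_pmul2l _ ((n.+1)`!%:R)%:E)// mule1.
rewrite -(integral_sum_permute Pexch mEE E0).
under eq_integral do rewrite /= sumEFin classical_conformal_sum//.
by rewrite integral_cst//= probability_setT mule1.
Qed.

End classical.

(** * The uniform law on the reorderings of a tuple *)

Section uniform_permutation.
Context d (Z : measurableType d) (R : realType) (n : nat) (t : n.-tuple Z).
Local Open Scope ereal_scope.

(** Permutations are numbered by their enumeration because [msum] takes a sequence of measures; the
    default [1%g] is never reached for [k < n!]. *)
Let dirac_permute (k : nat) : {measure set (n.-tuple Z) -> \bar R} :=
  \d_(permute (nth 1%g (enum {perm 'I_n}) k) t).

Let fact_inv : {nonneg R} := (((n`!%:R : R)^-1)%:nng)%R.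

Definition uniform_permutation : {measure set (n.-tuple Z) -> \bar R} :=
  mscale fact_inv (msum dirac_permute n`!).

Let big_dirac_permute (F : n.-tuple Z -> \bar R) :
  \sum_(k < n`!) F (permute (nth 1%g (enum {perm 'I_n}) k) t) =
  \sum_(g : {perm 'I_n}) F (permute g t).
Proof.
have <- : size (enum {perm 'I_n}) = n`! by rewrite -cardE card_Sn.
rewrite -(big_mkord xpredT
  (fun k => F (permute (nth 1%g (enum {perm 'I_n}) k) t))).
by rewrite -(big_nth _ xpredT (fun g => F (permute g t))) big_enum.
Qed.

Lemma uniform_permutationE A :
  uniform_permutation A =
  fact_inv%:num%:E * \sum_(g : {perm 'I_n}) \d_(permute g t) A.
Proof.
rewrite /uniform_permutation/= /mscale /msum /=.
by rewrite -(big_dirac_permute (fun u => \d_u A)).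
Qed.

Lemma integral_uniform_permutation f :
  measurable_fun setT f -> (forall u, 0 <= f u) ->
  \int[uniform_permutation]_u f u =
  fact_inv%:num%:E * \sum_(g : {perm 'I_n}) f (permute g t).
Proof.
move=> mf f0; rewrite ge0_integral_mscale//; congr (_ * _).
rewrite ge0_integral_measure_sum// -(big_dirac_permute f).
by apply: eq_bigr => k _; rewrite integral_dirac// diracT mul1e.
Qed.
End uniform_permutation.

Lemma valid_prediction_set_sum d (Z : measurableType d) (R : realType)
    (alpha : R) n (E : n.+1.-tuple Z -> R) t :
  valid_prediction_set alpha E ->
  \sum_(g : {perm 'I_n.+1}) E (permute g t) <= (n.+1)`!%:R.
Proof.
move=> [[mE E_itv] Evalid].
have fact0 : (0 < (n.+1)`!%:R :> R) by rewrite ltr0n fact_gt0.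
pose U := uniform_permutation R t.
have UT : U setT = 1%E.
  rewrite uniform_permutationE; under eq_bigr do rewrite diracT.
  rewrite (_ : (\sum_(g : {perm 'I_n.+1}) 1)%E = ((n.+1)`!%:R)%:E).
    by rewrite -EFinM/= mulVf// gt_eqF.
  by rewrite big_const -[RHS]mule1 mule_natl -card_Sn -Monoid.iteropE.
pose PU : probability (n.+1.-tuple Z) R := HB.pack (U : set _ -> \bar R)
  (Measure.class U) (Measure_isProbability.Build _ _ _ U UT).
have PUexch : exchangeable PU.
  move=> h A mA; rewrite /= [LHS]uniform_permutationE [RHS]uniform_permutationE.
  (* Reordering by [h] only translates the summation index in the permutation group. *)
  congr (_ * _)%E; rewrite [RHS](reindex_inj (mulgI h))/=.
  by apply: eq_bigr => g _; rewrite -permuteM.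
have := Evalid PU PUexch; rewrite unlock.
rewrite (_ : (\int[PU]_u (E u)%:E = \int[U]_u (E u)%:E)%E)//.
rewrite integral_uniform_permutation; last 2 first.
- exact/measurable_EFinP.
- by move=> u; rewrite lee_fin; case/andP: (E_itv u).
by rewrite sumEFin -EFinM lee_fin /= mulrC ler_pdivrMr// mul1r.
Qed.

(** * The Neyman-Pearson argument on one orbit *)

Section exchange_optimality.
Context d (Z : measurableType d) (R : realType).
Variables (low : bool) (alpha : R) (s : Z -> R) (n : nat).
Hypothesis alpha01 : 0 < alpha < 1.

(** With a critical weight [W], every product [(w - W) * (E - E')] is nonnegative: [E] is maximal
    where [w] exceeds [W] and zero where [w] falls short of it. The remaining term is [W] times the
    excess of the total of [E] over that of [E']. *)
Lemma classical_conformal_permute_optimal (E E' : n.+1.-tuple Z -> R)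
    (t : n.+1.-tuple Z) (w : 'I_n.+1 -> R) :
  classical_conformal low alpha s E -> valid_prediction_set alpha E' ->
  (forall i, 0 <= w i) ->
  (forall i j, orient low (s (tnth t i)) <= orient low (s (tnth t j)) ->
    w j <= w i) ->
  \sum_(g : {perm 'I_n.+1}) w (g ord_max) * (1 - alpha * E (permute g t)) <=
  \sum_(g : {perm 'I_n.+1}) w (g ord_max) * (1 - alpha * E' (permute g t)).
Proof.
move=> EC E'valid w0 w_anti.
have /andP[alpha0 _] := alpha01.
have E'sum := valid_prediction_set_sum t E'valid.
have Esum := classical_conformal_sum t EC.
have [[_ E'_itv] _] := E'valid.
have [c [k /(_ t)[_ EP _]]] := classical_conformalP EC.
pose y i := orient low (s (tnth t i)).
(* The largest weight among entries not below the threshold, or [0] if there are none. Entries at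
   the threshold have weight exactly [W], so the value of [k] does not matter. *)
pose W := \big[Num.max/0]_(i | c t <= y i) w i.
have W0 : 0 <= W.
  by rewrite /W; elim/big_ind: _ => // a b a0 b0; rewrite le_max a0.
have W_le v : 0 <= v -> (forall i, c t <= y i -> w i <= v) -> W <= v.
  move=> v0 wv; rewrite /W.
  by elim/big_ind: _ => // a b av bv; rewrite ge_max av.
have W_ge i : c t <= y i -> w i <= W.
  by move=> ci; rewrite /W (bigD1 i)//= le_max lexx.
have NP (g : {perm _}) : 0 <= (w (g ord_max) - W) *
    (E (permute g t) - E' (permute g t)).
  have /andP[E'0 E'a] := E'_itv (permute g t).
  rewrite EP -/(y _) /exclusion; case: ltgtP => yc.
  - rewrite mulr_ge0 ?subr_ge0//; apply: W_le => // i ci.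
    by apply: w_anti; exact: le_trans (ltW yc) ci.
  - by rewrite mulr_le0// ?subr_le0 ?sub0r ?oppr_le0// W_ge// ltW.
  - rewrite (_ : w _ - W = 0) ?mul0r//; apply/eqP.
    rewrite subr_eq0 eq_le W_ge ?yc//=; apply: W_le => // i ci.
    by apply: w_anti; rewrite -/(y _) yc.
have diffE :
    \sum_(g : {perm 'I_n.+1}) w (g ord_max) * (1 - alpha * E' (permute g t)) -
    \sum_(g : {perm 'I_n.+1}) w (g ord_max) * (1 - alpha * E (permute g t)) =
  alpha * (\sum_(g : {perm 'I_n.+1}) (w (g ord_max) - W) *
      (E (permute g t) - E' (permute g t)) +
    W * (\sum_(g : {perm 'I_n.+1}) E (permute g t) -
         \sum_(g : {perm 'I_n.+1}) E' (permute g t))).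
  rewrite -!sumrB mulr_sumr -big_split mulr_sumr; apply: eq_bigr => g _ /=.
  by ring.
rewrite -subr_ge0 diffE; apply: mulr_ge0; first exact: ltW.
apply: addr_ge0; first by apply: sumr_ge0 => g _; exact: NP.
by rewrite mulr_ge0// Esum subr_ge0.
Qed.

End exchange_optimality.

(** * Optimality *)

(** The function [q] is the everywhere finite version of the Radon-Nikodym derivative; it agrees
    with [p] almost everywhere because both have the same integrals over measurable sets. *)
Lemma density_real d (Z : measurableType d) (R : realType)
    (P : probability Z R) (mu : {sigma_finite_measure set Z -> \bar R})
    (p : Z -> \bar R) :
  is_density P mu p ->
  exists q : Z -> R,
  [/\ measurable_fun [set: Z] q, (forall z, 0 <= q z),
      {ae mu, forall z, p z = (q z)%:E} &
      forall f, measurable_fun [set: Z] f -> (forall z, 0 <= f z)%E ->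
        (\int[P]_z f z = \int[mu]_z (f z * (q z)%:E))%E].
Proof.
move=> [mp p0 Pp].
have Pmu : P `<< mu.
  apply/null_content_dominatesP => A mA muA0.
  rewrite Pp// null_set_integral//; exact: measurable_funTS.
pose f := Radon_Nikodym_SigmaFinite.f P mu.
have ffin z : f z \is a fin_num by exact: Radon_Nikodym_SigmaFinite.f_fin_num.
have f0 z : (0 <= f z)%E by exact: Radon_Nikodym_SigmaFinite.f_ge0.
have fint : mu.-integrable setT f.
  exact: Radon_Nikodym_SigmaFinite.f_integrable.
exists (fine \o f); split.
- by apply: measurableT_comp => //; exact: measurable_int fint.
- by move=> z /=; rewrite fine_ge0.
- have : ae_eq mu setT f p.
    apply: integral_ae_eq => // A _ mA.
    by rewrite -Pp// -Radon_Nikodym_SigmaFinite.f_integral.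
  by apply: filterS => z /(_ I) <- /=; rewrite fineK.
- move=> h mh h0.
  rewrite -(Radon_Nikodym_SigmaFinite.change_of_variables Pmu h0)//.
  by apply: eq_integral => z _ /=; rewrite fineK.
Qed.

(** The weight of a reordering thus depends only on which entry is the candidate. *)
Lemma prod_widen_permute (T : Type) (R : comPzRingType) n (q : T -> R)
    (g : {perm 'I_n.+1}) (t : n.+1.-tuple T) :
  \prod_(i < n) q (tnth (permute g t) (widen_ord (leqnSn n) i)) =
  \prod_(j < n.+1 | j != g ord_max) q (tnth t j).
Proof.
rewrite [RHS](reindex_inj (@perm_inj _ g)) [RHS]big_mkcond [RHS]big_ord_recr/=.
rewrite eqxx/= mulr1; apply: eq_bigr => i _.
by rewrite (inj_eq perm_inj) tnth_mktuple -val_eqE/= ltn_eqF.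
Qed.

(** For [i != j] the products share all factors except [q i] on the left and [q j] on the right;
    comparing these avoids dividing by a possibly zero density. *)
Lemma prod_neq_antitone (R : numDomainType) (I : finType) (q : I -> R) i j :
  (forall i, 0 <= q i) -> q i <= q j ->
  \prod_(l | l != j) q l <= \prod_(l | l != i) q l.
Proof.
move=> q0 qij; have [->//|ij] := eqVneq i j.
rewrite (bigD1 i)//= [leRHS](bigD1 j) 1?eq_sym//=.
rewrite (eq_bigl (fun l => (l != i) && (l != j))) => [|l]; last exact: andbC.
by rewrite ler_wpM2r// prodr_ge0.
Qed.

Theorem corollary2 (d : measure_display) (Z : measurableType d) (R : realType)
    (n : nat) (alpha : R) (halpha : 0 < alpha < 1)
    (s : Z -> R) (s_meas : measurable_fun [set: Z] s)
    (s_ge0 : forall z, 0 <= s z)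
    (P : probability Z R) (Pn : probability (n.-tuple Z) R)
    (Pn_iid : iid P Pn)
    (mu : {sigma_finite_measure set Z -> \bar R})
    (p : Z -> \bar R) (p_density : is_density P mu p)
    (incr : bool) (m : \bar R -> \bar R)
    (m_mono : strictly_monotone_nneg incr m)
    (s_eq : {ae mu, forall z, (s z)%:E = m (p z)}) :
  (exists E : n.+1.-tuple Z -> R, classical_conformal incr alpha s E) /\
  (forall E : n.+1.-tuple Z -> R, classical_conformal incr alpha s E ->
     valid_prediction_set alpha E /\
     (forall E' : n.+1.-tuple Z -> R, valid_prediction_set alpha E' ->
        (expected_size Pn mu alpha E <= expected_size Pn mu alpha E')%E)).
Proof.
split; first exact: classical_conformal_exists.
move=> E EC; have Evalid := classical_conformal_valid s_meas EC.
split=> // E' E'valid.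
have [q [mq q0 pq Pq]] := density_real p_density.
have [M Mmu] := product_measure_exists mu n.+1.
have Minv : permute_invariant M by exact: product_rule_permute_invariant Mmu.
pose w (t : n.+1.-tuple Z) :=
  \prod_(i < n) q (tnth t (widen_ord (leqnSn n) i)).
have w0 t : 0 <= w t by exact: prodr_ge0.
have mw : measurable_fun setT w by exact: measurable_prod_tnth.
(* The integrand of the expected size of [F] with respect to [M], the power of [mu]. *)
pose H F (t : n.+1.-tuple Z) : R := w t * (1 - alpha * F t).
have H0 F t : valid_prediction_set alpha F -> 0 <= H F t.
  move=> [[_ F_itv] _]; rewrite mulr_ge0// subr_ge0.
  have /andP[alpha0 _] := halpha.
  by rewrite mulrC -ler_pdivlMr// mul1r; case/andP: (F_itv t).
have mH F : valid_prediction_set alpha F -> measurable_fun setT (H F).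
  move=> [[mF _] _]; apply: measurable_funM => //.
  by apply: measurable_funB => //; exact: measurable_funM.
have sizeE F : valid_prediction_set alpha F ->
    expected_size Pn mu alpha F = (\int[M]_t (H F t)%:E)%E.
  move=> Fvalid; have [[mF F_itv] _] := Fvalid.
  rewrite /expected_size /prediction_set_size.
  rewrite (integral_iid_rcons (f := fun t => (1 - alpha * F t)%:E)
    mq q0 Pq Pn_iid Mmu).
  - by apply: eq_integral => t _; rewrite -EFinM mulrC.
  - apply/measurable_EFinP.
    by apply: measurable_funB => //; exact: measurable_funM.
  - move=> t; rewrite lee_fin subr_ge0; have /andP[alpha0 _] := halpha.
    by rewrite mulrC -ler_pdivlMr// mul1r; case/andP: (F_itv t).
rewrite !sizeE//.
have fact0 : (0 < (n.+1)`!%:R :> R) by rewrite ltr0n fact_gt0.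
(* A positive finite factor preserves the comparison even of infinite sizes, and turns each
   integrand into its sum over the orbit. *)
rewrite -(@lee_pmul2l _ ((n.+1)`!%:R)%:E)//.
have symE F : valid_prediction_set alpha F ->
  (((n.+1)`!%:R)%:E * \int[M]_t (H F t)%:E =
   \int[M]_t (\sum_(g : {perm 'I_n.+1}) H F (permute g t))%:E)%E.
  move=> Fvalid.
  rewrite -(integral_sum_permute Minv (f := fun t => (H F t)%:E)).
  - by apply: eq_integral => t _; rewrite sumEFin.
  - by apply/measurable_EFinP; exact: mH.
  - by move=> t; rewrite lee_fin H0.
rewrite !symE//.
have msym F : valid_prediction_set alpha F -> measurable_fun setT
    (fun t => (\sum_(g : {perm 'I_n.+1}) H F (permute g t))%:E).
  move=> Fvalid; apply/measurable_EFinP; apply: measurable_sum => g.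
  by apply: measurableT_comp; [exact: mH|exact: measurable_permute].
have sym0 F t : valid_prediction_set alpha F ->
    (0 <= (\sum_(g : {perm 'I_n.+1}) H F (permute g t))%:E)%E.
  by move=> Fvalid; rewrite lee_fin sumr_ge0// => g _; exact: H0.
apply: ae_ge0_le_integral => //; [by move=> t _; exact: sym0|exact: msym|
  by move=> t _; exact: sym0|exact: msym|].
(* Outside a null set of tuples, all entries satisfy the score identity at once, now with the finite
   density [q]. *)
have sq : {ae mu, forall z, (s z)%:E = m (q z)%:E}.
  by apply: filterS2 s_eq pq => z -> ->.
apply: filterS (product_rule_ae Mmu sq) => t st _; rewrite lee_fin.
under eq_bigr do rewrite /H /w prod_widen_permute.
under [leRHS]eq_bigr do rewrite /H /w prod_widen_permute.
apply: (classical_conformal_permute_optimal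
  (w := fun i => \prod_(j | j != i) q (tnth t j)) halpha EC E'valid).
  by move=> i; exact: prodr_ge0.
move=> i j sij; apply: (@prod_neq_antitone _ _ (fun l => q (tnth t l))) => //.
(* Strict monotonicity of [m] would turn a strict density inequality into a strict inequality of
   oriented scores, against [sij]; in particular, tied scores come from equal densities. *)
rewrite leNgt; apply/negP => qji.
have := m_mono (q (tnth t j))%:E (q (tnth t i))%:E.
rewrite !lee_fin !lte_fin => /(_ (q0 _) qji).
rewrite -!st; move: sij; rewrite /orient; case: (incr).
  by rewrite lte_fin leNgt => /negP.
by rewrite lte_fin lerN2 leNgt => /negP.
Qed.
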